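(* Let $K$ be a virtual or welded knot, and let $m,n\geq 0$ be integers. If $K$ admits an $(m,n)$-unknottable diagram $D$, then $$m(K)\leq a(K)\leq m+n,$$ where $m(K)$ is the Nakanishi index of $K$ and $a(K)$ is the Ma-Qiu index of $K$.
   Context: For a virtual or welded knot $K$, the knot group $G(K)$ is the group given by the Wirtinger presentation of a diagram of $K$: generators correspond to arcs running from one classical under-crossing to the next (virtual crossings are ignored), with one Wirtinger relation for each classical crossing. For a group $G$, the Ma-Qiu index $a(G)$ is the minimum number of elements of $[G,G]$ whose normal closure in $G$ equals $[G,G]$, and the Nakanishi index $m(G)$ is the minimum number of generators of $[G,G]/[[G,G],[G,G]]$ as a $\mathbb{Z}[G/[G,G]]$-module. Set $a(K)=a(G(K))$ and $m(K)=m(G(K))$. A virtualization is the move on virtual knot diagrams that replaces a classical crossing (of either type) with a virtual crossing. A crossing change exchanges the over- and under-strands at a classical crossing. A virtual or welded knot diagram $D$ is $(m,n)$-unknottable if $D$ can be converted to a diagram of the trivial knot by applying $m$ virtualizations and $n$ crossing changes. *)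

(* Defs.v *)
From HB Require Import structures.
From Stdlib Require Import Relation_Operators.
From mathcomp Require Import all_boot all_algebra.
From mathcomp Require Import boolp constructive_ereal.
From mathcomp Require Import freeg.

Set Implicit Arguments.
Unset Strict Implicit.
Unset Printing Implicit Defensive.

Import GRing.Theory.

Local Open Scope quotient_scope.

Section Subgroups.
Local Open Scope group_scope.
Variable G : groupType.

Definition subgroup_gen (A : {pred G}) : {pred G} :=
  fun x => `[< forall H : {pred G},
    group_closed H -> {subset A <= H} -> x \in H >].

Definition normal_closure (A : {pred G}) : {pred G} :=
  fun x => `[< forall H : {pred G},
    group_closed H -> (forall y z, y \in H -> y ^ z \in H) ->
    {subset A <= H} -> x \in H >].

Definition commutators : {pred G} :=
  fun z => `[< exists x y, z = [~ x, y] >].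

Definition derived : {pred G} := subgroup_gen commutators.

Lemma subgroup_gen_sub (A : {pred G}) : {subset A <= subgroup_gen A}.
Proof. by move=> x Ax; apply/asboolP => H _; apply. Qed.

Lemma subgroup_gen_min (A H : {pred G}) :
  group_closed H -> {subset A <= H} -> {subset subgroup_gen A <= H}.
Proof. by move=> gH AH x /asboolP; apply. Qed.

Lemma subgroup_gen_closed (A : {pred G}) : group_closed (subgroup_gen A).
Proof.
split=> [|x y /asboolP Ax /asboolP Ay]; apply/asboolP => H gH AH.
  by case: gH.
by case: (gH) => _; apply; [apply: Ax | apply: Ay].
Qed.

Lemma derivedR x y : [~ x, y] \in derived.
Proof. by apply: subgroup_gen_sub; apply/asboolP; exists x, y. Qed.

Lemma derived1 : 1 \in derived.
Proof. by case: (subgroup_gen_closed commutators). Qed.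

Lemma derivedM x y : x \in derived -> y \in derived -> x * y \in derived.
Proof. exact: (group_closedM (subgroup_gen_closed _)). Qed.

Lemma derivedV x : x \in derived -> x^-1 \in derived.
Proof. exact: (group_closedV (subgroup_gen_closed _)). Qed.

Lemma derivedJ x y : x \in derived -> x ^ y \in derived.
Proof.
by move=> dx; rewrite -[x ^ y](mulVKg x) derivedM// -commgEl derivedR.
Qed.

End Subgroups.
Arguments commutators G : clear implicits.
Arguments derived G : clear implicits.

Definition derived_group (G : groupType) : Type := {x : G | x \in derived G}.

HB.instance Definition _ (G : groupType) :=
  SubChoice.on (derived_group G).
HB.instance Definition _ (G : groupType) :=
  SubChoice_isSubGroup.Build G (derived G) (derived_group G)
    (subgroup_gen_closed _).

Section Abelianization.
Local Open Scope group_scope.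
Variable G : groupType.

Definition abel_rel : rel G := fun x y => x^-1 * y \in derived G.

Lemma abel_rel_equiv : equiv_class_of abel_rel.
Proof.
split=> [x | x y | y x z].
- by rewrite /abel_rel mulVg derived1.
- apply/idP/idP => /derivedV; rewrite /abel_rel invgM invgK //.
move=> xy yz; rewrite /abel_rel -(mulgK y x^-1) -mulgA.
exact: derivedM.
Qed.
Canonical abel_equiv := EquivRelPack abel_rel_equiv.

Definition abel : Type := {eq_quot abel_rel}.
HB.instance Definition _ := EqQuotient.on abel.
HB.instance Definition _ := Choice.on abel.

Implicit Types (u v : abel).

Lemma abelP x y : \pi_abel x = \pi_abel y <-> x^-1 * y \in derived G.
Proof. by split=> [/eqquotP|dxy]; [|apply/eqquotP]. Qed.

Definition abel_one : abel := \pi_abel 1.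
Definition abel_mul u v : abel := \pi_abel (repr u * repr v).
Definition abel_inv u : abel := \pi_abel (repr u)^-1.

Lemma abel_mulE x y : abel_mul (\pi_abel x) (\pi_abel y) = \pi_abel (x * y).
Proof.
apply/abelP; set x' := repr _; set y' := repr _.
have dx : x'^-1 * x \in derived G by apply/abelP; rewrite reprK.
have dy : y'^-1 * y \in derived G by apply/abelP; rewrite reprK.
have -> : (x' * y')^-1 * (x * y) = (x'^-1 * x) ^ y' * (y'^-1 * y).
  by rewrite conjgE invgM !mulgA mulgK.
by rewrite derivedM// derivedJ.
Qed.

Lemma abel_invE x : abel_inv (\pi_abel x) = \pi_abel x^-1.
Proof.
apply/abelP; set x' := repr _; rewrite invgK.
have dx : x'^-1 * x \in derived G by apply/abelP; rewrite reprK.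
have -> : x' * x^-1 = (x'^-1 * x)^-1 ^ x'^-1.
  by rewrite conjgE !invgM !invgK !mulgA mulgK.
by rewrite derivedJ// derivedV.
Qed.

Lemma abel_mulA : associative abel_mul.
Proof.
elim/quotW=> x; elim/quotW=> y; elim/quotW=> z.
rewrite (abel_mulE y z) (abel_mulE x (y * z)) (abel_mulE x y).
by rewrite (abel_mulE (x * y) z) mulgA.
Qed.

Lemma abel_mulC : commutative abel_mul.
Proof.
elim/quotW=> x; elim/quotW=> y; rewrite (abel_mulE x) (abel_mulE y); apply/abelP.
by rewrite invgM -mulgA derivedR.
Qed.

Lemma abel_mul1 : left_id abel_one abel_mul.
Proof. by elim/quotW=> x; rewrite (abel_mulE 1 x) mul1g. Qed.

Lemma abel_mulr1 : right_id abel_one abel_mul.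
Proof. by elim/quotW=> x; rewrite (abel_mulE x 1) mulg1. Qed.

Lemma abel_mulV : left_inverse abel_one abel_inv abel_mul.
Proof. by elim/quotW=> x; rewrite (abel_invE x) (abel_mulE x^-1) mulVg. Qed.

Lemma abel_mulrV : right_inverse abel_one abel_inv abel_mul.
Proof. by elim/quotW=> x; rewrite (abel_invE x) (abel_mulE x x^-1) mulgV. Qed.

HB.instance Definition _ := isGroup.Build abel
  abel_mulA abel_mul1 abel_mulr1 abel_mulV abel_mulrV.

Lemma abel_piM x y : \pi_abel (x * y) = \pi_abel x * \pi_abel y.
Proof. exact/esym/abel_mulE. Qed.

Lemma abel_commute u v : u * v = v * u.
Proof. exact: abel_mulC. Qed.

End Abelianization.
Arguments abel G : clear implicits.

Definition group_ring (H : groupType) : Type := {freeg H / int}.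

Section GroupRing.
Local Open Scope ring_scope.
Variable H : groupType.

HB.instance Definition _ := GRing.Zmodule.on (group_ring H).

Definition gring_lift (M : zmodType) (f : H -> M) (a : group_ring H) : M :=
  fglift (f : H -> zmodule M) a.

Definition gring_of (h : H) : group_ring H := << 1 *g h >>.

Definition gring_mul (a b : group_ring H) : group_ring H :=
  gring_lift (fun g => gring_lift (fun h => gring_of (g * h)%g) b) a.

Lemma gring_liftB (M : zmodType) (f : H -> M) :
  {morph gring_lift f : a b / a - b}.
Proof. exact: (@lift_is_additive _ _ (zmodule M)). Qed.

HB.instance Definition _ (M : zmodType) (f : H -> M) :=
  GRing.isZmodMorphism.Build (group_ring H) M (gring_lift f) (gring_liftB f).

Lemma gring_lift_of (M : zmodType) (f : H -> M) h :
  gring_lift f (gring_of h) = f h.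
Proof. by rewrite /gring_lift /gring_of liftU scale1r. Qed.

Lemma gring_sumE (a : group_ring H) :
  a = \sum_(h <- dom a) gring_of h *~ coeff h a.
Proof.
rewrite -[LHS]freeg_sumE; apply: eq_bigr => h _.
by rewrite -[in LHS](intz (coeff h a)) -freegU_mulz.
Qed.

Lemma gring_ext (M : zmodType) (f g : group_ring H -> M) :
  {morph f : a b / a - b} -> {morph g : a b / a - b} ->
  (forall h, f (gring_of h) = g (gring_of h)) -> f =1 g.
Proof.
move=> fB gB fg a.
pose F := GRing.isZmodMorphism.Build _ _ f fB.
pose f' : {additive group_ring H -> M} := HB.pack f F.
pose F' := GRing.isZmodMorphism.Build _ _ g gB.
pose g' : {additive group_ring H -> M} := HB.pack g F'.
have -> : f = f' by []. have -> : g = g' by [].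
rewrite [a]gring_sumE !raddf_sum; apply: eq_bigr => h _.
by rewrite !raddfMz /= fg.
Qed.

Definition gring_one : group_ring H := gring_of 1%g.

Lemma gring_mulBl b : {morph gring_mul^~ b : a a' / a - a'}.
Proof. exact: gring_liftB. Qed.

Lemma gring_mulBr a : {morph gring_mul a : b b' / b - b'}.
Proof.
move=> b b'; move: a; apply: gring_ext; try exact: gring_liftB.
  by move=> a a'; rewrite !gring_mulBl !opprD addrACA.
by move=> h; rewrite /gring_mul !gring_lift_of gring_liftB.
Qed.

Lemma gring_mul_of g h : gring_mul (gring_of g) (gring_of h) = gring_of (g * h)%g.
Proof. by rewrite /gring_mul !gring_lift_of. Qed.

Lemma gring_mulA : associative gring_mul.
Proof.
move=> a b c; move: a; apply: gring_ext => [||g].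
- by move=> a a'; rewrite gring_mulBl.
- by move=> a a'; rewrite !gring_mulBl.
move: b; apply: gring_ext => [b b'|b b'|h].
- by rewrite gring_mulBl gring_mulBr.
- by rewrite gring_mulBr gring_mulBl.
move: c; apply: gring_ext => [c c'|c c'|k].
- by rewrite !gring_mulBr.
- by rewrite gring_mulBr.
by rewrite !gring_mul_of mulgA.
Qed.

Lemma gring_mul1 : left_id gring_one gring_mul.
Proof.
apply: gring_ext => [a b|//|h]; first by rewrite gring_mulBr.
by rewrite gring_mul_of mul1g.
Qed.

Lemma gring_mulr1 : right_id gring_one gring_mul.
Proof.
apply: gring_ext => [a b|//|h]; first by rewrite gring_mulBl.
by rewrite gring_mul_of mulg1.
Qed.

Lemma zmod_morphismD (U V : zmodType) (f : U -> V) :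
  {morph f : a b / a - b} -> {morph f : a b / a + b}.
Proof.
move=> fB a b; have f0 : f 0 = 0 by rewrite -[0 in LHS](subrr 0) fB subrr.
by rewrite -{1}[b]opprK fB -[- b in LHS]sub0r fB f0 sub0r opprK.
Qed.

Lemma gring_mulDl : left_distributive gring_mul +%R.
Proof. by move=> a b c; apply: zmod_morphismD (gring_mulBl c) _ _. Qed.

Lemma gring_mulDr : right_distributive gring_mul +%R.
Proof. by move=> a; apply: zmod_morphismD (gring_mulBr a). Qed.

Lemma gring_one_neq0 : gring_one != 0.
Proof. by rewrite /gring_one /gring_of freegU_eq0 oner_eq0. Qed.

HB.instance Definition _ := GRing.Zmodule_isNzRing.Build (group_ring H)
  gring_mulA gring_mul1 gring_mulr1 gring_mulDl gring_mulDr gring_one_neq0.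

End GroupRing.

(* [G,G] / [[G,G],[G,G]], a group written additively below. *)
Definition alexander_module (G : groupType) : Type := abel (derived_group G).

Section AlexanderModule.
Variable G : groupType.
Local Notation M := (alexander_module G).

HB.instance Definition _ := Choice.on M.

Local Notation pi_M := (\pi_(abel (derived_group G)) : derived_group G -> M).

Definition alex_add (x y : M) : M :=
  ((x : abel (derived_group G)) * (y : abel (derived_group G)))%g.
Definition alex_opp (x : M) : M := ((x : abel (derived_group G))^-1)%g.
Definition alex_zero : M := (1%g : abel (derived_group G)).

HB.instance Definition _ := GRing.isZmodule.Build M
  (@mulgA (abel (derived_group G)) : associative alex_add)
  (@abel_commute _ : commutative alex_add)
  (@mul1g _ : left_id alex_zero alex_add)
  (@mulVg _ : left_inverse alex_zero alex_opp alex_add).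

Definition derived_conj (g : G) (x : derived_group G) : derived_group G :=
  Sub (val x ^ g^-1)%g (derivedJ (g^-1)%g (valP x)).

(* The class of g acts on the class of x as the class of g x g^-1. *)
Definition alex_act (h : abel G) (x : M) : M :=
  pi_M (derived_conj (repr h) (repr (x : abel (derived_group G)))).

Local Open Scope ring_scope.

Lemma derived_conjM g x y :
  derived_conj g (x * y)%g = (derived_conj g x * derived_conj g y)%g.
Proof. by apply: val_inj; rewrite !SubK /= conjMg. Qed.

Lemma pi_MD x y : pi_M (x * y)%g = pi_M x + pi_M y.
Proof. exact: abel_piM. Qed.

Lemma derived_conj_derived g x : x \in derived (derived_group G) ->
  derived_conj g x \in derived (derived_group G).
Proof.
pose S : {pred derived_group G} :=
  fun x => derived_conj g x \in derived (derived_group G).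
apply: (@subgroup_gen_min _ _ S).
  split=> [|u v Su Sv]; rewrite -topredE /= /S.
    have -> : derived_conj g 1%g = 1%g by apply: val_inj; rewrite /= conj1g.
    exact: derived1.
  rewrite derived_conjM derivedM//.
  have -> : derived_conj g v^-1%g = ((derived_conj g v)^-1)%g.
    by apply: (mulgI (derived_conj g v)); rewrite -derived_conjM !mulgV;
      apply: val_inj; rewrite /= conj1g.
  exact: derivedV.
move=> z /asboolP[u [v ->]]; rewrite -topredE /= /S.
have -> : derived_conj g [~ u, v]%g = [~ derived_conj g u, derived_conj g v]%g.
  by apply: val_inj; rewrite /= conjRg.
exact: derivedR.
Qed.

Lemma pi_M_conj g x y : pi_M x = pi_M y ->
  pi_M (derived_conj g x) = pi_M (derived_conj g y).
Proof.
move=> /abelP dxy; apply/abelP.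
have -> : ((derived_conj g x)^-1 * derived_conj g y)%g =
          derived_conj g (x^-1 * y)%g.
  by apply: val_inj; rewrite /= conjMg conjVg.
exact: derived_conj_derived.
Qed.

Lemma alex_actE g x : alex_act (\pi_(abel G) g) (pi_M x) = pi_M (derived_conj g x).
Proof.
rewrite /alex_act; set g' := repr _; set x' := repr _.
have -> : pi_M (derived_conj g' x') = pi_M (derived_conj g' x).
  by apply: pi_M_conj; rewrite /x' reprK.
have dg : (g'^-1 * g)%g \in derived G by apply/abelP; rewrite reprK.
pose d : derived_group G := Sub (g'^-1 * g)%g dg.
have -> : derived_conj g x = derived_conj g' (x ^ d^-1)%g.
  by apply: val_inj; rewrite /= -conjgE -conjgM invgM invgK mulgK.
apply: pi_M_conj; apply/abelP.
by rewrite -commgEl derivedR.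
Qed.

Lemma alex_actB h : {morph alex_act h : x y / x - y}.
Proof.
elim/quotW: h => g; elim/(@quotW _ (abel (derived_group G))) => x.
elim/(@quotW _ (abel (derived_group G))) => y.
have -> : (pi_M x - pi_M y) = pi_M (x * y^-1)%g.
  by rewrite pi_MD; congr (_ + _); apply: abel_invE.
rewrite !alex_actE derived_conjM pi_MD; congr (_ + _).
apply: etrans (esym (abel_invE (derived_conj g y))); congr pi_M.
by apply: val_inj; rewrite /= conjVg.
Qed.

Lemma alex_actM h k x : alex_act (h * k)%g x = alex_act h (alex_act k x).
Proof.
elim/quotW: h => g; elim/quotW: k => k.
elim/(@quotW _ (abel (derived_group G))): x => x.
rewrite -abel_piM (alex_actE k x) (alex_actE g) alex_actE; congr pi_M.
by apply: val_inj; rewrite /= invgM conjgM.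
Qed.

Lemma alex_act1 x : alex_act 1%g x = x.
Proof.
elim/(@quotW _ (abel (derived_group G))): x => x.
rewrite -[1%g]/(\pi_(abel G) 1%g) alex_actE; congr pi_M.
by apply: val_inj; rewrite /= invg1 conjg1.
Qed.

Definition alex_scale (a : group_ring (abel G)) (x : M) : M :=
  gring_lift (fun h => alex_act h x) a.

Lemma alex_scaleBl x : {morph alex_scale^~ x : a b / a - b}.
Proof. exact: gring_liftB. Qed.

Lemma alex_scale_of h x : alex_scale (gring_of h) x = alex_act h x.
Proof. exact: gring_lift_of. Qed.

Lemma alex_scaleBr a : {morph alex_scale a : x y / x - y}.
Proof.
move=> x y; move: a; apply: gring_ext => [|a b|h].
- exact: alex_scaleBl.
- by rewrite !alex_scaleBl !opprD addrACA.
by rewrite !alex_scale_of alex_actB.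
Qed.

Lemma alex_scaleA a b x : alex_scale a (alex_scale b x) = alex_scale (a * b) x.
Proof.
move: a; apply: gring_ext => [a a'|a a'|h].
- by rewrite alex_scaleBl.
- by rewrite mulrBl alex_scaleBl.
move: b; apply: gring_ext => [b b'|b b'|k].
- by rewrite alex_scaleBl alex_scaleBr.
- by rewrite mulrBr alex_scaleBl.
rewrite [gring_of h * _]gring_mul_of !alex_scale_of.
by rewrite alex_actM.
Qed.

Lemma alex_scale1 : left_id 1 alex_scale.
Proof. by move=> x; rewrite [LHS]alex_scale_of alex_act1. Qed.

Lemma alex_scaleDr : right_distributive alex_scale +%R.
Proof. by move=> a; apply: zmod_morphismD (alex_scaleBr a). Qed.

Lemma alex_scaleDl x : {morph alex_scale^~ x : a b / a + b}.
Proof. exact: zmod_morphismD (alex_scaleBl x). Qed.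

HB.instance Definition _ :=
  GRing.Zmodule_isLmodule.Build (group_ring (abel G)) M
    alex_scaleA alex_scale1 alex_scaleDr alex_scaleDl.

End AlexanderModule.

Local Open Scope ring_scope.

(* The least n satisfying P, or +oo if there is none. *)
Definition least (P : nat -> Prop) : \bar int :=
  if pselect (exists n, `[< P n >]) is left exP then (ex_minn exP)%:Z%:E
  else +oo%E.

Definition ma_qiu_index (G : groupType) : \bar int :=
  least (fun n => exists s : n.-tuple G,
    {subset s <= derived G} /\ normal_closure (mem s) =i derived G).

Definition nakanishi_index (G : groupType) : \bar int :=
  least (fun n => exists s : n.-tuple (alexander_module G),
    forall x : alexander_module G, exists a : 'I_n -> group_ring (abel G),
      x = \sum_(i < n) a i *: tnth s i).

Section Presentation.
Local Open Scope group_scope.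
Variable I : choiceType.

(* A letter (x, false) stands for the generator x, (x, true) for its inverse. *)
Definition gword : Type := seq (I * bool).

Definition gword_inv (w : gword) : gword := rev [seq (l.1, ~~ l.2) | l <- w].

Variable rels : seq (gword * gword).

Inductive pres_eq : gword -> gword -> Prop :=
| PresRefl u : pres_eq u u
| PresSym u v : pres_eq u v -> pres_eq v u
| PresTrans u v w : pres_eq u v -> pres_eq v w -> pres_eq u w
| PresCat u u' v v' : pres_eq u u' -> pres_eq v v' -> pres_eq (u ++ v) (u' ++ v')
| PresCancel l : pres_eq [:: l; (l.1, ~~ l.2)] [::]
| PresRel r : r \in rels -> pres_eq r.1 r.2.

Definition pres_rel : rel gword := fun u v => `[< pres_eq u v >].

Lemma pres_rel_equiv : equiv_class_of pres_rel.
Proof.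
split=> [u|u v|v u w].
- exact/asboolP/PresRefl.
- by apply/asboolP/asboolP; apply: PresSym.
by move=> /asboolP uv /asboolP vw; apply/asboolP/(PresTrans uv).
Qed.
Canonical pres_equiv := EquivRelPack pres_rel_equiv.

Definition pres_group : Type := {eq_quot pres_rel}.
HB.instance Definition _ := EqQuotient.on pres_group.
HB.instance Definition _ := Choice.on pres_group.

Lemma presP u v : \pi_pres_group u = \pi_pres_group v <-> pres_eq u v.
Proof. by split=> [/eqquotP/asboolP|uv]; [|apply/eqquotP/asboolP]. Qed.

Lemma pres_repr u : pres_eq (repr (\pi_pres_group u)) u.
Proof. by apply/presP; rewrite reprK. Qed.

Definition pres_one : pres_group := \pi_pres_group [::].
Definition pres_mul (x y : pres_group) : pres_group :=
  \pi_pres_group (repr x ++ repr y).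
Definition pres_inv (x : pres_group) : pres_group :=
  \pi_pres_group (gword_inv (repr x)).

Lemma gword_invK : involutive gword_inv.
Proof.
move=> w; rewrite /gword_inv map_rev revK -map_comp.
by rewrite map_id_in// => -[x b] _ /=; rewrite negbK.
Qed.

Lemma gword_inv_cat u v : gword_inv (u ++ v) = gword_inv v ++ gword_inv u.
Proof. by rewrite /gword_inv map_cat rev_cat. Qed.

Lemma pres_eq_invr w : pres_eq (w ++ gword_inv w) [::].
Proof.
elim: w => [|l w IH]; first exact: PresRefl.
rewrite -cat1s gword_inv_cat -catA [w ++ _]catA.
apply: (PresTrans _ (PresCancel l)).
rewrite -[X in pres_eq _ X]/([:: l] ++ ([::] ++ gword_inv [:: l])).
apply: PresCat; first exact: PresRefl.
by apply: PresCat; first exact: IH; apply: PresRefl.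
Qed.

Lemma pres_eq_invl w : pres_eq (gword_inv w ++ w) [::].
Proof. by rewrite -{2}[w]gword_invK; apply: pres_eq_invr. Qed.

Lemma pres_eq_inv u v : pres_eq u v -> pres_eq (gword_inv u) (gword_inv v).
Proof.
move=> uv; apply: (@PresTrans _ (gword_inv u ++ (v ++ gword_inv v))).
  rewrite -[X in pres_eq X _]cats0; apply: PresCat; first exact: PresRefl.
  by apply: PresSym; apply: pres_eq_invr.
rewrite catA -[X in pres_eq _ X]cat0s; apply: PresCat; last exact: PresRefl.
apply: PresTrans (pres_eq_invl u); apply: PresCat; first exact: PresRefl.
exact: PresSym.
Qed.

Lemma pres_mulE u v :
  pres_mul (\pi_pres_group u) (\pi_pres_group v) = \pi_pres_group (u ++ v).
Proof. by apply/presP/PresCat; apply: pres_repr. Qed.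

Lemma pres_invE u :
  pres_inv (\pi_pres_group u) = \pi_pres_group (gword_inv u).
Proof. by apply/presP/pres_eq_inv/pres_repr. Qed.

Lemma pres_mulA : associative pres_mul.
Proof.
elim/quotW=> u; elim/quotW=> v; elim/quotW=> w.
rewrite (pres_mulE v w) (pres_mulE u (v ++ w)) (pres_mulE u v).
by rewrite (pres_mulE (u ++ v) w) catA.
Qed.

Lemma pres_mul1 : left_id pres_one pres_mul.
Proof. by elim/quotW=> u; rewrite (pres_mulE [::] u). Qed.

Lemma pres_mulr1 : right_id pres_one pres_mul.
Proof. by elim/quotW=> u; rewrite (pres_mulE u [::]) cats0. Qed.

Lemma pres_mulV : left_inverse pres_one pres_inv pres_mul.
Proof.
elim/quotW=> u; rewrite (pres_invE u) (pres_mulE _ u).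
exact/presP/pres_eq_invl.
Qed.

Lemma pres_mulrV : right_inverse pres_one pres_inv pres_mul.
Proof.
elim/quotW=> u; rewrite (pres_invE u) (pres_mulE u).
exact/presP/pres_eq_invr.
Qed.

HB.instance Definition _ := isGroup.Build pres_group
  pres_mulA pres_mul1 pres_mulr1 pres_mulV pres_mulrV.

End Presentation.

Local Close Scope ring_scope.

(* A virtual knot diagram is given by its signed Gauss code: the cyclic word
   of the classical crossings met along the oriented knot, starting at some
   base point.  A letter (c, o, s) is a passage through the crossing labelled
   c, over if o = true and under if o = false, and s = true iff the crossing is
   positive.  Virtual crossings leave no trace in the code: the code, up to
   rotation and relabelling, is the same data as the planar diagram up to the
   moves that involve virtual crossings (detour moves). *)
Definition letter : Type := (nat * bool * bool)%type.

Definition crossing (l : letter) : nat := l.1.1.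
Definition over (l : letter) : bool := l.1.2.
Definition positive (l : letter) : bool := l.2.

(* Each crossing is met once over and once under, with the same sign. *)
Definition gauss_code (w : seq letter) : bool :=
  uniq [seq l.1 | l <- w] &&
  all (fun l => (crossing l, ~~ over l, positive l) \in w) w.

Record diagram := Diagram { gcode :> seq letter; gcodeP : gauss_code gcode }.

HB.instance Definition _ := [isSub for gcode].
HB.instance Definition _ := [Choice of diagram by <:].

Definition trivial_diagram : diagram := @Diagram [::] isT.

Definition crossings (D : diagram) : seq nat := undup [seq crossing l | l <- D].

(* The two strands x, y in the order of traversal given by b. *)
Definition pass (b : bool) (x y : letter) : seq letter :=
  if b then [:: x; y] else [:: y; x].

Inductive knot_theory := Virtual | Welded.

(* Reidemeister moves on Gauss codes.  In the third move, t, m and b are the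
   codes of the top, middle and bottom strands of the triangle, whose crossings
   x = t/m, y = t/b, z = m/b have signs sx, sy, sz; k tells on which side of z
   the top strand passes.  For three oriented lines in general position,
   t meets x before y iff k = sx sy sz, m meets x before z iff k = sx, and
   b meets y before z iff k = sy (as signs +1, -1). *)
Inductive reidemeister : knot_theory -> seq letter -> seq letter -> Prop :=
| Rotate th u v : reidemeister th (u ++ v) (v ++ u)
| Relabel th (f : nat -> nat) w : injective f ->
    reidemeister th w [seq (f (crossing l), over l, positive l) | l <- w]
| Reid1 th c o s u :
    reidemeister th ([:: (c, o, s); (c, ~~ o, s)] ++ u) u
| Reid2 th x y o s b u v :
    reidemeister th
      ([:: (x, o, s); (y, o, ~~ s)] ++ u ++
       pass b (x, ~~ o, s) (y, ~~ o, ~~ s) ++ v)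
      (u ++ v)
| Reid3 th x y z sx sy sz k (cyc : bool) u v w :
    let top k := pass (k == sx (+) sy (+) sz) (x, true, sx) (y, true, sy) in
    let mid k := pass (k == sx) (x, false, sx) (z, true, sz) in
    let bot k := pass (k == sy) (y, false, sy) (z, false, sz) in
    let tri k :=
      if cyc then top k ++ u ++ mid k ++ v ++ bot k ++ w
      else top k ++ u ++ bot k ++ v ++ mid k ++ w in
    reidemeister th (tri k) (tri (~~ k))
| OverCommute x y sx sy u :
    reidemeister Welded ([:: (x, true, sx); (y, true, sy)] ++ u)
                        ([:: (y, true, sy); (x, true, sx)] ++ u).

Definition diagram_equiv (th : knot_theory) : rel diagram := fun D E =>
  `[< clos_refl_sym_trans diagram (fun A B => reidemeister th A B) D E >].

Lemma diagram_equiv_class th : equiv_class_of (diagram_equiv th).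
Proof.
split=> [A|A B|B A C].
- exact/asboolP/rst_refl.
- by apply/asboolP/asboolP; apply: rst_sym.
by move=> /asboolP AB /asboolP BC; apply/asboolP; apply: rst_trans AB BC.
Qed.
Canonical diagram_equiv_rel th := EquivRelPack (diagram_equiv_class th).

Definition knot (th : knot_theory) : Type := {eq_quot diagram_equiv th}.
HB.instance Definition _ th := EqQuotient.on (knot th).

(* K is the virtual, resp. welded, knot represented by the diagram D. *)
Definition represents th (D : diagram) (K : knot th) : Prop :=
  \pi_(knot th) D = K.

Definition trivial_knot th : knot th := \pi_(knot th) trivial_diagram.

Section Wirtinger.
Variable w : seq letter.

Definition unders (u : seq letter) : nat := count (fun l => ~~ over l) u.

(* Arcs are numbered along the knot from the base point; with n > 0 under-
   passages there are n arcs, arc n being arc 0, and without crossings the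
   whole knot is one arc. *)
Definition arc_type : Type := 'I_(unders w).-1.+1.
HB.instance Definition _ := Choice.on arc_type.

(* The arc containing the point just before the i-th passage. *)
Definition arc (i : nat) : arc_type := inZp (unders (take i w)).

(* Under-passage i, through a crossing of sign s with overpassing arc o:
   outgoing arc = o^(-s) (incoming arc) o^s. *)
Definition wirtinger_rel (i : nat) : gword arc_type * gword arc_type :=
  let l := nth (0, false, false) w i in
  let s := positive l in
  let o := arc (index (crossing l, true, s) w) in
  ([:: (arc i.+1, false)], [:: (o, s); (arc i, false); (o, ~~ s)]).

Definition wirtinger_rels : seq (gword arc_type * gword arc_type) :=
  [seq wirtinger_rel i |
    i <- iota 0 (size w) & ~~ over (nth (0, false, false) w i)].

Definition wirtinger_group : groupType := pres_group wirtinger_rels.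

End Wirtinger.

(* Up to isomorphism the group does not depend on the diagram of K. *)
Definition knot_group th (K : knot th) : groupType := wirtinger_group (repr K).

Lemma virtualize_subproof (D : diagram) c :
  gauss_code [seq l <- D | crossing l != c].
Proof.
case: D => w /= /andP[uw /allP dw]; apply/andP; split.
  exact: subseq_uniq (map_subseq _ (filter_subseq _ _)) uw.
by apply/allP => l; rewrite !mem_filter => /andP[-> /dw].
Qed.

(* A crossing made virtual disappears from the code. *)
Definition virtualize (D : diagram) (c : nat) : diagram :=
  Diagram (virtualize_subproof D c).

Definition change_letter (c : nat) (l : letter) : letter :=
  if crossing l == c then (crossing l, ~~ over l, ~~ positive l) else l.

Lemma crossing_change_subproof (D : diagram) c :
  gauss_code [seq change_letter c l | l <- D].
Proof.
case: D => w /= /andP[uw /allP dw].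
have fE l : (change_letter c l).1 =
    (crossing l, if crossing l == c then ~~ over l else over l).
  by rewrite /change_letter; case: ifP => //; case: l => -[].
apply/andP; split.
  pose f (p : nat * bool) := (p.1, if p.1 == c then ~~ p.2 else p.2).
  have -> : [seq l.1 | l <- [seq change_letter c l | l <- w]] =
            map f [seq l.1 | l <- w].
    by rewrite -!map_comp; apply: eq_map => l /=; rewrite fE.
  rewrite map_inj_uniq// => -[a b] [a' b'] [<-].
  by case: ifP => _ => [/negb_inj ->|->].
apply/allP => _ /mapP[l lw ->]; apply/mapP.
exists (crossing l, ~~ over l, positive l); first exact: dw.
by rewrite /change_letter /crossing /=; case: (l.1.1 == c).
Qed.

Definition crossing_change (D : diagram) (c : nat) : diagram :=
  Diagram (crossing_change_subproof D c).

Inductive unknottable (th : knot_theory) : nat -> nat -> diagram -> Prop :=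
| UnknotTrivial D : represents D (trivial_knot th) -> unknottable th 0 0 D
| UnknotVirtualize m n D c : c \in crossings D ->
    unknottable th m n (virtualize D c) -> unknottable th m.+1 n D
| UnknotChange m n D c : c \in crossings D ->
    unknottable th m n (crossing_change D c) -> unknottable th m n.+1 D.

(* Main.v *)
From HB Require Import structures.
From mathcomp Require Import all_boot all_algebra constructive_ereal.
From mathcomp Require Import boolp zify.
Require Import Defs.

(** A homomorphism from the knot group of a diagram to a group G is a coloring:
    one element of G per arc, with a Wirtinger relation at each crossing; it is
    onto exactly when the colors generate G.  The upper bound is proved for
    every group G generated by a coloring of a diagram D that is
    (m, n)-unknottable: the derived subgroup of G is the normal closure of
    m + n of its elements (unknottable_derived).  It suffices to apply this to
    the knot group itself, which its diagram colors tautologically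
    (coloring_generates_wirtinger).

    Along the Gauss code a coloring is a state machine: the current color must
    agree with the color of the overpass c at an over-passage of c, and is
    conjugated by it at an under-passage.  Hence a coloring is a starting color
    together with one color per crossing, the color of its overpass, and
    colorings of a concatenation are composed from those of the pieces.  A
    Reidemeister move turns a generating coloring into a generating coloring of
    the other code in the same group, by recoloring only the crossings of the
    move (coloring_generates_equiv).

    Let z be the commutator of the two colors p and o that meet at a crossing c.
    In G / <<z>> they commute, so the color p goes through the crossing
    unchanged.  The coloring of D therefore descends to a generating coloring of
    the diagram in which c is virtual, as well as to one of the diagram in which
    c is changed: there p becomes the overpass color, and it acts trivially on
    o (coloring_generates_quot).  As z lies in the derived subgroup, lifting
    normal generators of the derived subgroup of G / <<z>> and adding z gives
    normal generators for G (derived_normally_generated_quot): each step costs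
    one element.  After the last step the code is equivalent to the empty one,
    so that the group is cyclic and its derived subgroup is trivial.

    For the lower bound, let s normally generate the derived subgroup G'.  The
    elements of G' whose class lies in the submodule spanned by the classes of s
    form a normal subgroup of G, since conjugation acts on G' / G'' as a group
    ring element.  It contains s, hence is all of G' (class_tuple_span). *)

Set Implicit Arguments.
Unset Strict Implicit.
Unset Printing Implicit Defensive.

Import GRing.Theory.

Local Open Scope quotient_scope.
Local Open Scope group_scope.

(** * Normal closures and quotient groups *)

Section NormalClosure.
Variable G : groupType.
Implicit Types A N : {pred G}.

Definition normal_subgroup N : Prop :=
  group_closed N /\ (forall y z, y \in N -> y ^ z \in N).

Lemma normal_closure_sub A : {subset A <= normal_closure A}.
Proof. by move=> x Ax; apply/asboolP => H _ _; apply. Qed.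

Lemma normal_closure_min A N :
  normal_subgroup N -> {subset A <= N} -> {subset normal_closure A <= N}.
Proof. by move=> [gN nN] AN x /asboolP; apply. Qed.

Lemma normal_closure_normal A : normal_subgroup (normal_closure A).
Proof.
split; first split.
- by apply/asboolP => N [].
- move=> x y /asboolP Ax /asboolP Ay; apply/asboolP => N gN nN AN.
  by case: (gN) => _; apply; [apply: Ax | apply: Ay].
by move=> x y /asboolP Ax; apply/asboolP => N gN nN AN; apply/nN/Ax.
Qed.

Lemma derived_normal : normal_subgroup (derived G).
Proof. by split; [exact: subgroup_gen_closed | exact: derivedJ]. Qed.

End NormalClosure.

Section Quotient.
Variables (G : groupType) (A : {pred G}).
Local Notation N := (normal_closure A).

Let gN : group_closed N. Proof. by case: (normal_closure_normal A). Qed.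
Let N1 : 1 \in N. Proof. by case: gN. Qed.
Let NM x y : x \in N -> y \in N -> x * y \in N.
Proof. exact: group_closedM gN x y. Qed.
Let NV x : x \in N -> x^-1 \in N. Proof. exact: group_closedV gN x. Qed.
Let NJ x y : x \in N -> x ^ y \in N.
Proof. by case: (normal_closure_normal A) => _; apply. Qed.

Definition quot_rel : rel G := fun x y => x^-1 * y \in N.

Lemma quot_rel_equiv : equiv_class_of quot_rel.
Proof.
split=> [x | x y | y x z].
- by rewrite /quot_rel mulVg.
- by apply/idP/idP => /NV; rewrite /quot_rel invgM invgK.
by move=> xy yz; rewrite /quot_rel -(mulgK y x^-1) -mulgA NM.
Qed.
Canonical quot_equiv := EquivRelPack quot_rel_equiv.

Definition quot : Type := {eq_quot quot_rel}.
HB.instance Definition _ := EqQuotient.on quot.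
HB.instance Definition _ := Choice.on quot.

Lemma quotP x y : \pi_quot x = \pi_quot y <-> x^-1 * y \in N.
Proof. by split=> [/eqquotP|xy]; [|apply/eqquotP]. Qed.

Definition quot_mul (u v : quot) : quot := \pi_quot (repr u * repr v).
Definition quot_inv (u : quot) : quot := \pi_quot (repr u)^-1.

Lemma quot_mulE x y : quot_mul (\pi_quot x) (\pi_quot y) = \pi_quot (x * y).
Proof.
apply/quotP; set x' := repr _; set y' := repr _.
have Nx : x'^-1 * x \in N by apply/quotP; rewrite reprK.
have Ny : y'^-1 * y \in N by apply/quotP; rewrite reprK.
have -> : (x' * y')^-1 * (x * y) = (x'^-1 * x) ^ y' * (y'^-1 * y).
  by rewrite conjgE invgM !mulgA mulgK.
by rewrite NM ?NJ.
Qed.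

Lemma quot_invE x : quot_inv (\pi_quot x) = \pi_quot x^-1.
Proof.
apply/quotP; set x' := repr _; rewrite invgK.
have Nx : x'^-1 * x \in N by apply/quotP; rewrite reprK.
have -> : x' * x^-1 = (x'^-1 * x)^-1 ^ x'^-1.
  by rewrite conjgE !invgM !invgK !mulgA mulgK.
by rewrite NJ ?NV.
Qed.

Fact quot_mulA : associative quot_mul.
Proof.
elim/quotW=> x; elim/quotW=> y; elim/quotW=> z.
by rewrite (quot_mulE y z) (quot_mulE x) (quot_mulE x y) (quot_mulE _ z) mulgA.
Qed.

Fact quot_mul1 : left_id (\pi_quot 1) quot_mul.
Proof. by elim/quotW=> x; rewrite (quot_mulE 1 x) mul1g. Qed.

Fact quot_mulr1 : right_id (\pi_quot 1) quot_mul.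
Proof. by elim/quotW=> x; rewrite (quot_mulE x 1) mulg1. Qed.

Fact quot_mulV : left_inverse (\pi_quot 1) quot_inv quot_mul.
Proof. by elim/quotW=> x; rewrite (quot_invE x) (quot_mulE _ x) mulVg. Qed.

Fact quot_mulrV : right_inverse (\pi_quot 1) quot_inv quot_mul.
Proof. by elim/quotW=> x; rewrite (quot_invE x) (quot_mulE x) mulgV. Qed.

HB.instance Definition _ := isGroup.Build quot
  quot_mulA quot_mul1 quot_mulr1 quot_mulV quot_mulrV.

Definition quot_pi (x : G) : quot := \pi_quot x.

Fact quot_piM : {morph quot_pi : x y / x * y}.
Proof. by move=> x y; apply/esym/quot_mulE. Qed.
Fact quot_pi1 : quot_pi 1 = 1. Proof. by []. Qed.

HB.instance Definition _ := isMultiplicative.Build G quot quot_pi quot_piM.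
HB.instance Definition _ :=
  Multiplicative_isUMagmaMorphism.Build G quot quot_pi quot_pi1.

Lemma quot_pi_surj (q : quot) : exists x, quot_pi x = q.
Proof. by exists (repr q); apply: reprK. Qed.

Lemma quot_pi_eq x y : quot_pi x = quot_pi y <-> x^-1 * y \in N.
Proof. exact: quotP. Qed.

End Quotient.

Section Image.
Variables (G H : groupType) (f : UMagmaMorphism.type G H).
Hypothesis f_surj : forall y, exists x, f x = y.

Definition image_pred (N : {pred G}) : {pred H} :=
  fun y => `[< exists2 x, x \in N & f x = y >].

Lemma image_predP N y :
  reflect (exists2 x, x \in N & f x = y) (y \in image_pred N).
Proof. exact: asboolP. Qed.

Lemma image_pred_normal N : normal_subgroup N -> normal_subgroup (image_pred N).
Proof.
move=> [[N1 NF] NJ]; split; first split.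
- by apply/image_predP; exists 1; rewrite ?gmulf1.
- move=> _ _ /image_predP[x Nx <-] /image_predP[y Ny <-].
  by apply/image_predP; exists (x / y); [exact: NF | rewrite gmulfF].
move=> _ z /image_predP[y Ny <-]; have [x <-] := f_surj z.
by apply/image_predP; exists (y ^ x); [exact: NJ | rewrite gmulfJ].
Qed.

(** The image of G' is a normal subgroup containing the commutators of H, as
    their entries lift. *)
Lemma derived_lift y : y \in derived H -> exists2 x, x \in derived G & f x = y.
Proof.
move=> dy; apply/image_predP; move: y dy; apply: subgroup_gen_min.
  by case: (image_pred_normal (derived_normal G)).
move=> _ /asboolP[u [v ->]]; have [x <-] := f_surj u; have [y <-] := f_surj v.
by apply/image_predP; exists [~ x, y]; rewrite ?derivedR ?gmulfR.
Qed.

Lemma morph_derived x : x \in derived G -> f x \in derived H.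
Proof.
pose S : {pred G} := fun x => f x \in derived H.
apply: (@subgroup_gen_min _ _ S) => [|_ /asboolP[u [v ->]]].
  have [d1 dF] := subgroup_gen_closed (commutators H).
  by split=> [|u v Su Sv]; rewrite -topredE /= /S ?gmulf1 ?gmulfF //; apply: dF.
by rewrite -topredE /= /S gmulfR derivedR.
Qed.

End Image.

Definition derived_normally_generated (G : groupType) (n : nat) : Prop :=
  exists s : n.-tuple G,
    {subset s <= derived G} /\ normal_closure (mem s) =i derived G.

(** The new generators are z and lifts to [G, G] of the given ones.  If K is
    their normal closure and h lies in [G, G], some k in K has the same image as
    h; then k^-1 h is in <<z>>, which K contains. *)
Lemma derived_normally_generated_quot (G : groupType) (z : G) n :
  z \in derived G -> derived_normally_generated (quot (pred1 z)) n ->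
  derived_normally_generated G n.+1.
Proof.
move=> dz [s [sd sE]]; pose f := @quot_pi G (pred1 z).
have f_surj : forall q, exists x, f x = q := @quot_pi_surj _ _.
have /choice[g gP] (q : quot (pred1 z)) :
    exists x, q \in derived (quot (pred1 z)) -> x \in derived G /\ f x = q.
  case: (boolP (q \in derived _)) => [/(derived_lift f_surj)[x dx fx]|_].
    by exists x.
  by exists 1.
pose t := cons_tuple z (map_tuple g s).
have td : {subset t <= derived G}.
  move=> x; rewrite inE => /predU1P[->//|/mapP[q qs ->]].
  by have [] := gP q (sd q qs).
exists t; split=> // x; apply/idP/idP.
  by apply: normal_closure_min => //; apply: derived_normal.
move=> dx; have nK := normal_closure_normal (mem t).
have : f x \in image_pred f (normal_closure (mem t)).
  have : f x \in normal_closure (mem s) by rewrite sE; apply: morph_derived.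
  apply: normal_closure_min => [|q qs]; first exact: image_pred_normal.
  have [_ <-] := gP q (sd q qs); apply/image_predP; exists (g q) => //.
  by apply: normal_closure_sub; rewrite !inE map_f ?orbT.
move=> /image_predP[y Ky /quot_pi_eq yx].
rewrite -(mulVKg y x); case: nK => gK JK; apply: (group_closedM gK) => //.
move: yx; apply: normal_closure_min => // _ /eqP->.
by apply: normal_closure_sub; rewrite !inE eqxx.
Qed.

(** * Colorings of Gauss codes *)

Definition occurrences (c : nat) (w : seq letter) : nat :=
  count (fun l => crossing l == c) w.

Section Colorings.
Variable G : groupType.
Implicit Types (x : nat -> G) (a b p q : G) (w u v : seq letter) (S : {pred G}).

Definition signed_conj (s : bool) (a o : G) : G :=
  if s then a ^ o else a ^ o^-1.

(** A strand of color a that traverses w comes out with color b, where x c is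
    the color of the arc passing over the crossing c. *)
Fixpoint colored x a w b : Prop :=
  if w is l :: w' then
    if over l then x (crossing l) = a /\ colored x a w' b
    else colored x (signed_conj (positive l) a (x (crossing l))) w' b
  else a = b.

Lemma colored_cat x a u v b :
  colored x a (u ++ v) b <-> exists2 p, colored x a u p & colored x p v b.
Proof.
elim: u a => [|l u IH] a /=; first by split=> [cv|[p -> //]]; exists a.
case: (over l); rewrite ?IH //; split; first by move=> [? [p]]; exists p.
by move=> [p [? ?] ?]; split=> //; exists p.
Qed.

Lemma eq_colored x x' a w b :
  {in w, forall l, x (crossing l) = x' (crossing l)} ->
  colored x a w b -> colored x' a w b.
Proof.
elim: w a => //= l w IH a xx'; have xl := xx' l (mem_head _ _).
have {}IH p : colored x p w b -> colored x' p w b.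
  by apply: IH => k kw; apply: xx'; rewrite inE kw orbT.
by case: (over l); rewrite -xl; [case=> -> /IH | apply: IH].
Qed.

Lemma signed_conj_closed S s a o :
  group_closed S -> a \in S -> o \in S -> signed_conj s a o \in S.
Proof.
move=> gS Sa So; have [SM SV] := (group_closedM gS, group_closedV gS).
by case: s; rewrite /signed_conj conjgE ?invgK !(SM, SV).
Qed.

(** The colors of all arcs are obtained from the starting color by conjugation
    with the overpass colors of the under-passages. *)
Lemma colored_closed S x a w b : group_closed S -> a \in S ->
  {in w, forall l, ~~ over l -> x (crossing l) \in S} ->
  colored x a w b ->
  b \in S /\ {in w, forall l, over l -> x (crossing l) \in S}.
Proof.
move=> gS; elim: w a => [|l w IH] a Sa Sx /=; first by move=> <-.
have Sx' : {in w, forall l, ~~ over l -> x (crossing l) \in S}.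
  by move=> k kw; apply: Sx; rewrite inE kw orbT.
case: ifP => ol.
  move=> [xl /(IH _ Sa Sx')[Sb Sw]]; split=> // k.
  by rewrite inE => /predU1P[-> _|/Sw//]; rewrite xl.
have Sl : x (crossing l) \in S by rewrite Sx ?mem_head ?ol.
move=> /(IH _ (signed_conj_closed _ gS Sa Sl) Sx')[Sb Sw]; split=> // k.
by rewrite inE => /predU1P[->|/Sw//]; rewrite ol.
Qed.

Definition set_color x (c : nat) (o : G) : nat -> G :=
  fun d => if d == c then o else x d.

Lemma set_color_fresh x c o w : occurrences c w = 0 ->
  {in w, forall l, set_color x c o (crossing l) = x (crossing l)}.
Proof.
move=> /eqP; rewrite -leqn0 leqNgt -has_count => /hasPn cw l /cw.
by rewrite /set_color => /negbTE ->.
Qed.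

Lemma colored_set_color x c o a w b : occurrences c w = 0 ->
  colored x a w b -> colored (set_color x c o) a w b.
Proof.
by move=> cw; apply: eq_colored => l /(set_color_fresh x o cw).
Qed.

(** All arc colors belong to the subgroup generated by a and the overpass
    colors, by colored_closed. *)
Definition generating x a w : Prop :=
  forall S, group_closed S -> a \in S ->
    {in w, forall l, x (crossing l) \in S} -> forall h, h \in S.

Definition coloring_generates w : Prop :=
  exists x a, colored x a w a /\ generating x a w.

End Colorings.

(** * Invariance under Reidemeister moves *)

Section Invariance.
Variable G : groupType.
Implicit Types (u v w : seq letter).

(** This bound yields every freshness condition below: a crossing that shows up
    twice in the part of the code affected by a move occurs nowhere else. *)
Lemma gauss_code_occurrences c w : gauss_code w -> occurrences c w <= 2.
Proof.
move=> /andP[uw _].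
have -> : occurrences c w =
    count_mem (c, true) (map fst w) + count_mem (c, false) (map fst w).
  rewrite /occurrences !count_map; elim: w {uw} => //= -[[d o] s] w ->.
  by rewrite /crossing /= !xpair_eqE; case: (d == c); case: o; lia.
by rewrite !count_uniq_mem //; case: (_ \in _); case: (_ \in _).
Qed.

Lemma in_forall_cat u v (P : letter -> Prop) :
  {in u ++ v, forall l, P l} <-> {in u, forall l, P l} /\ {in v, forall l, P l}.
Proof.
split=> [uv|[Pu Pv] l]; last by rewrite mem_cat => /orP[/Pu|/Pv].
by split=> l lu; apply: uv; rewrite mem_cat lu ?orbT.
Qed.

Lemma in_forall_cons k v (P : letter -> Prop) :
  {in k :: v, forall l, P l} <-> P k /\ {in v, forall l, P l}.
Proof.
split=> [kv|[Pk Pv] l]; last by rewrite inE => /predU1P[->//|/Pv].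
by split=> [|l lv]; apply: kv; rewrite inE ?eqxx ?lv ?orbT.
Qed.

Lemma coloring_generates_rotate u v :
  coloring_generates G (u ++ v) -> coloring_generates G (v ++ u).
Proof.
move=> [x [a [/colored_cat[p au pv] gen]]]; exists x, p; split.
  by apply/colored_cat; exists a.
move=> S gS Sp /in_forall_cat[Sv Su].
apply: (gen S gS); last exact/in_forall_cat.
by have [] := colored_closed gS Sp (fun l lv _ => Sv l lv) pv.
Qed.

Lemma colored_relabel (f : nat -> nat) (x : nat -> G) a w b :
  colored x a [seq (f (crossing l), over l, positive l) | l <- w] b <->
  colored (x \o f) a w b.
Proof.
by elim: w a => //= l w IH a; rewrite /crossing /over /=; case: ifP; rewrite IH.
Qed.

Lemma coloring_generates_relabel (f : nat -> nat) w : injective f ->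
  coloring_generates G w <->
  coloring_generates G [seq (f (crossing l), over l, positive l) | l <- w].
Proof.
move=> f_inj; split=> -[x [a [cw gen]]].
  (* The labels of w are the only ones on which x must be transported; the
     inverse of f is computed by looking up the position of a label. *)
  pose cs := map crossing w.
  pose x' n := x (nth 0 cs (index n (map f cs))).
  have x'E l : l \in w -> x' (f (crossing l)) = x (crossing l).
    by move=> lw; rewrite /x' index_map // nth_index // map_f.
  exists x', a; split.
    by apply/colored_relabel; apply: eq_colored cw => l /x'E.
  move=> S gS Sa Sx; apply: (gen S gS Sa) => l lw; rewrite -x'E //.
  exact: (Sx (f (crossing l), over l, positive l) (map_f _ lw)).
exists (x \o f), a; split; first exact/colored_relabel.
by move=> S gS Sa Sx; apply: (gen S gS Sa) => _ /mapP[l lw ->]; apply: Sx.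
Qed.

Lemma signed_conjK s (a o : G) : signed_conj s (signed_conj (~~ s) a o) o = a.
Proof. by case: s; rewrite /signed_conj /= (conjgK, conjgKV). Qed.

Lemma signed_conjKV s (a o : G) : signed_conj (~~ s) (signed_conj s a o) o = a.
Proof. by rewrite -{2}[s]negbK signed_conjK. Qed.

Lemma signed_conj_commute s (a o : G) : commute a o -> signed_conj s a o = a.
Proof.
by move=> ao; case: s; apply/conjg_fixP/commgP=> //; apply: commuteV.
Qed.

Lemma signed_conj_id s (a : G) : signed_conj s a a = a.
Proof. exact: signed_conj_commute. Qed.

Lemma signed_conj_eq s (a o : G) : signed_conj s a o = o -> a = o.
Proof.
by move=> ao; rewrite -[a](signed_conjKV s _ o) ao signed_conj_id.
Qed.

(** If the strand enters the kink by the under-passage, its color a becomes the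
    color of the overpass by conjugation with that color; hence it was equal to
    it.  So all arcs of the kink have the color a. *)
Lemma coloring_generates_reid1 c o s u :
  gauss_code ([:: (c, o, s); (c, ~~ o, s)] ++ u) ->
  coloring_generates G ([:: (c, o, s); (c, ~~ o, s)] ++ u) <->
  coloring_generates G u.
Proof.
move=> /(gauss_code_occurrences c) gc; have cu : occurrences c u = 0.
  by move: gc; rewrite /occurrences count_cat /= eqxx; lia.
split=> -[x [a [cw gen]]].
  have [xc au] : x c = a /\ colored x a u a.
    move: cw; rewrite /= /over /crossing /positive; case: (o) => /=.
      by move=> [->]; rewrite signed_conj_id.
    move=> [/esym/[dup]/signed_conj_eq <-].
    by rewrite signed_conj_id => _; split.
  exists x, a; split=> // S gS Sa Sx; apply: (gen S gS Sa).
  apply/in_forall_cat; split=> // l.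
  by rewrite !inE => /orP[]/eqP->; rewrite /crossing /= xc.
exists (set_color x c a), a; split.
  have au : colored (set_color x c a) a u a by apply: colored_set_color.
  rewrite /= /over /crossing /positive; have -> : set_color x c a c = a.
    by rewrite /set_color eqxx.
  by case: (o); rewrite /= signed_conj_id.
move=> S gS Sa /in_forall_cat[_ Su]; apply: (gen S gS Sa) => l lu.
by rewrite -(set_color_fresh x a cu lu) Su.
Qed.

Lemma colored_pass_over (x : nat -> G) k c d s t a b :
  colored x a (pass k (c, true, s) (d, true, t)) b <->
  [/\ x c = a, x d = a & a = b].
Proof. by case: k; split=> [[? []]|[]]. Qed.

Lemma colored_pass_under2 (x : nat -> G) k c d s a b : x c = x d ->
  colored x a (pass k (c, false, s) (d, false, ~~ s)) b <-> a = b.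
Proof.
move=> cd; case: k; rewrite /= /crossing /positive /= cd.
  by rewrite signed_conjKV.
by rewrite signed_conjK.
Qed.

(** The two conjugations by the overpassing strand, of color q, cancel; both
    crossings get the color q. *)
Lemma coloring_generates_reid2 c d o s b u v :
  let w := [:: (c, o, s); (d, o, ~~ s)] ++ u ++
           pass b (c, ~~ o, s) (d, ~~ o, ~~ s) ++ v in
  gauss_code w -> coloring_generates G w <-> coloring_generates G (u ++ v).
Proof.
move=> w gw; have occ e : occurrences e w =
    ((c == e) + (d == e)).*2 + occurrences e (u ++ v).
  rewrite /occurrences /w !count_cat; case: b {w gw};
    by rewrite /= /crossing /=; case: eqP; case: eqP; lia.
have cuv : occurrences c (u ++ v) = 0.
  by move: (gauss_code_occurrences c gw); rewrite occ eqxx; lia.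
have duv : occurrences d (u ++ v) = 0.
  by move: (gauss_code_occurrences d gw); rewrite occ eqxx; lia.
(* If o holds the first strand, of color a, passes over the second, and
   otherwise it passes under it. *)
have key (x : nat -> G) a e : colored x a w e <->
    exists2 p, let q := if o then a else p in
      [/\ x c = q, x d = q & colored x a u p] & colored x p v e.
  rewrite /w -[[:: _; _]]/(pass true (c, o, s) (d, o, ~~ s)); split.
    move=> /colored_cat[a' aa' /colored_cat[p a'p /colored_cat[p' pp' p'e]]].
    suff [xc [xd [Ea Ep]]] : let q := if o then a else p in
        x c = q /\ x d = q /\ a = a' /\ p = p'.
      by rewrite -Ea in a'p; rewrite -Ep in p'e; exists p.
    case: (o) aa' pp'.
      move=> /colored_pass_over[xc xd aa']; have cd : x c = x d by rewrite xc.
      by move=> /(colored_pass_under2 _ _ _ _ cd).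
    move=> aa' /colored_pass_over[xc xd pp']; have cd : x c = x d by rewrite xc.
    by move/(colored_pass_under2 _ _ _ _ cd): aa'.
  move=> [p [xc xd ap] pe].
  apply/colored_cat; exists a.
    by case: (o) xc xd => xc xd;
      [apply/colored_pass_over | apply/colored_pass_under2; rewrite // xc].
  apply/colored_cat; exists p => //; apply/colored_cat; exists p => //.
  by case: (o) xc xd => xc xd;
    [apply/colored_pass_under2; rewrite // xc | apply/colored_pass_over].
split=> -[x [a [cw gen]]].
  have [p /= [xc xd ap] pa] := (key x a a).1 cw.
  exists x, a; split; first by apply/colored_cat; exists p.
  move=> S gS Sa /in_forall_cat[Su Sv]; apply: (gen S gS Sa).
  have [Sp _] := colored_closed gS Sa (fun l lu _ => Su l lu) ap.
  have Sq : (if o then a else p) \in S by case: ifP.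
  apply/in_forall_cat; split=> [l|].
    by rewrite !inE => /orP[]/eqP->; rewrite /crossing /= ?xc ?xd.
  apply/in_forall_cat; split=> //; apply/in_forall_cat; split=> // l.
  case: (b) => /=; rewrite !inE => /orP[]/eqP->;
    by rewrite /crossing /= ?xc ?xd.
have [p ap pa] := (colored_cat x a u v a).1 cw.
pose q := if o then a else p.
pose x' := set_color (set_color x c q) d q.
have x'E : {in u ++ v, forall l, x' (crossing l) = x (crossing l)}.
  by move=> l luv; rewrite /x' !(@set_color_fresh _ _ _ _ (u ++ v)).
have [uE vE] := (in_forall_cat _ _ _).1 x'E.
have x'd : x' d = q by rewrite /x' /set_color eqxx.
have x'c : x' c = q by rewrite /x' /set_color eqxx; case: eqP.
exists x', a; split.
  apply/key; exists p; last by apply: eq_colored pa => l /vE.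
  by split=> //; apply: eq_colored ap => l /uE.
move=> S gS Sa /in_forall_cat[_ /in_forall_cat[Su /in_forall_cat[_ Sv]]].
apply: (gen S gS Sa); apply/in_forall_cat; split=> l lw.
  by rewrite -uE ?Su.
by rewrite -vE ?Sv.
Qed.

(** The middle strand passes under the top strand before it meets z on one side
    of the move, and after that on the other side.  Whether its color at z is
    conjugated by the top color or by its inverse depends on k only, and not on
    the sign sx. *)
Lemma colored_reid3_mid (x x' : nat -> G) c e sx sz k a b :
  x' c = x c -> x' e = signed_conj (~~ k) (x e) (x c) ->
  colored x a (pass (k == sx) (c, false, sx) (e, true, sz)) b ->
  colored x' a (pass (~~ k == sx) (c, false, sx) (e, true, sz)) b.
Proof.
move=> xc; case: k; case: sx => xe; rewrite /= /crossing /positive /= xc xe;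
  by move=> [-> <-]; rewrite /signed_conj ?conjgK ?conjgKV.
Qed.

(** Conjugations by the colors of the middle and of the top strand are exchanged
    by the identity (b ^ e) ^ d = (b ^ d) ^ (e ^ d). *)
Lemma colored_reid3_bot (x x' : nat -> G) d e sy sz k a b :
  x' d = x d -> x' e = signed_conj (~~ k) (x e) (x d) ->
  colored x a (pass (k == sy) (d, false, sy) (e, false, sz)) b ->
  colored x' a (pass (~~ k == sy) (d, false, sy) (e, false, sz)) b.
Proof.
move=> xd xe.
case: k xe; case: sy; case: sz => /= xe;
  rewrite /crossing /positive /= xd xe => <-;
  by rewrite /signed_conj /conjg !gnorm.
Qed.

(** Sliding the top strand, of color t, across the crossing z of the other two
    changes the color of the overpass of z by conjugation with t or t^-1, while
    each of the three strands comes out with the same color as before.  The move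
    is its own inverse up to exchanging k and ~~ k. *)
Lemma coloring_generates_reid3 cx cy cz sx sy sz k (cyc : bool) u v w :
  let top k := pass (k == sx (+) sy (+) sz) (cx, true, sx) (cy, true, sy) in
  let mid k := pass (k == sx) (cx, false, sx) (cz, true, sz) in
  let bot k := pass (k == sy) (cy, false, sy) (cz, false, sz) in
  let tri k :=
    if cyc then top k ++ u ++ mid k ++ v ++ bot k ++ w
    else top k ++ u ++ bot k ++ v ++ mid k ++ w in
  gauss_code (tri k) ->
  coloring_generates G (tri k) -> coloring_generates G (tri (~~ k)).
Proof.
move=> top mid bot tri gt [x [a [ct gen]]].
have occ c : occurrences c (tri k) = ((cx == c) + (cy == c) + (cz == c)).*2 +
    (occurrences c u + occurrences c v + occurrences c w).
  have passE b l m :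
      occurrences c (pass b l m) = (crossing l == c) + (crossing m == c).
    by case: b; rewrite /occurrences /=; lia.
  by rewrite /tri /occurrences; case: (cyc); rewrite !count_cat
    -!/(occurrences c _) !passE /crossing /=; lia.
have occz := gauss_code_occurrences cz gt; rewrite occ eqxx in occz.
have [uz vz wz] : [/\ occurrences cz u = 0, occurrences cz v = 0 &
    occurrences cz w = 0] by split; lia.
have xz : (cx == cz) = false by apply/negbTE; lia.
have yz : (cy == cz) = false by apply/negbTE; lia.
pose x' := set_color x cz (signed_conj (~~ k) (x cz) (x cx)).
have x'x : x' cx = x cx by rewrite /x' /set_color xz.
have x'y : x' cy = x cy by rewrite /x' /set_color yz.
have x'z : x' cz = signed_conj (~~ k) (x cz) (x cx).
  by rewrite /x' /set_color eqxx.
have topP p q : colored x p (top k) q ->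
    x cx = x cy /\ colored x' p (top (~~ k)) q.
  move=> /colored_pass_over[xp yp pq]; split; first by rewrite xp.
  by apply/colored_pass_over; rewrite x'x x'y.
have midP p q : colored x p (mid k) q -> colored x' p (mid (~~ k)) q.
  exact: colored_reid3_mid.
have xy : x cx = x cy.
  by move: ct; rewrite /tri; case: (cyc) => /colored_cat[p /topP[]].
have botP p q : colored x p (bot k) q -> colored x' p (bot (~~ k)) q.
  by apply: colored_reid3_bot; rewrite // -xy.
exists x', a; split.
  move: ct; rewrite /tri; case: (cyc).
    move=> /colored_cat[p1 /topP[_ c1] /colored_cat[p2 c2 /colored_cat[p3 c3]]].
    move=> /colored_cat[p4 c4 /colored_cat[p5 c5 c6]].
    apply/colored_cat; exists p1 => //.
    apply/colored_cat; exists p2; first exact: colored_set_color.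
    apply/colored_cat; exists p3; first exact: midP.
    apply/colored_cat; exists p4; first exact: colored_set_color.
    by apply/colored_cat; exists p5; [apply: botP | apply: colored_set_color].
  move=> /colored_cat[p1 /topP[_ c1] /colored_cat[p2 c2 /colored_cat[p3 c3]]].
  move=> /colored_cat[p4 c4 /colored_cat[p5 c5 c6]].
  apply/colored_cat; exists p1 => //.
  apply/colored_cat; exists p2; first exact: colored_set_color.
  apply/colored_cat; exists p3; first exact: botP.
  apply/colored_cat; exists p4; first exact: colored_set_color.
  by apply/colored_cat; exists p5; [apply: midP | apply: colored_set_color].
move=> S gS Sa Sx; apply: (gen S gS Sa).
have passE b l m n : (n \in pass b l m) = (n == l) || (n == m).
  by case: b; rewrite !inE // orbC.
have {}Sx l : l \in tri k -> x' (crossing l) \in S.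
  by move=> lk; apply: Sx; move: lk; rewrite /tri; case: (cyc);
    rewrite !mem_cat !passE.
have Scx : x cx \in S.
  rewrite -x'x; apply: (Sx (cx, true, sx)).
  by rewrite /tri; case: (cyc); rewrite mem_cat passE eqxx.
have Scz : x cz \in S.
  rewrite -[x cz](signed_conjK k _ (x cx)) -x'z.
  apply: signed_conj_closed => //.
  by apply: (Sx (cz, true, sz)); rewrite /tri; case: (cyc);
    rewrite !mem_cat !passE eqxx !orbT.
move=> l /Sx; rewrite /x' /set_color; case: eqP => // -> _.
exact: Scz.
Qed.

Lemma coloring_generates_over_commute c d s t u :
  coloring_generates G ([:: (c, true, s); (d, true, t)] ++ u) ->
  coloring_generates G ([:: (d, true, t); (c, true, s)] ++ u).
Proof.
move=> [x [a [[xc [xd cu]] gen]]]; exists x, a; split=> // S gS Sa Sx.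
by apply: (gen S gS Sa) => l lw; apply: Sx; move: lw; rewrite !inE orbCA.
Qed.

Lemma coloring_generates_reidemeister th w w' : reidemeister th w w' ->
  gauss_code w -> gauss_code w' ->
  coloring_generates G w <-> coloring_generates G w'.
Proof.
case=> {th w w'}.
- by move=> _ u v _ _; split; apply: coloring_generates_rotate.
- by move=> _ f w f_inj _ _; apply: coloring_generates_relabel.
- by move=> _ c o s u gw _; apply: coloring_generates_reid1.
- by move=> _ c d o s b u v gw _; apply: coloring_generates_reid2.
- move=> _ c d e sx sy sz k cyc u v w top mid bot tri gw gw'.
  split; first exact: coloring_generates_reid3.
  by rewrite -{2}[k]negbK; apply: coloring_generates_reid3.
by move=> c d s t u _ _; split; apply: coloring_generates_over_commute.
Qed.

Lemma coloring_generates_equiv th (D E : diagram) :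
  diagram_equiv th D E -> coloring_generates G D <-> coloring_generates G E.
Proof.
move=> /asboolP; elim=> {D E} [D E DE|D|D E _ IH|D E F _ DE _ EF].
- exact: coloring_generates_reidemeister DE (gcodeP D) (gcodeP E).
- by [].
- exact: iff_sym.
exact: iff_trans DE EF.
Qed.

End Invariance.

(** * Virtualizing and changing a crossing *)

Section Morphism.
Variables (G H : groupType) (f : UMagmaMorphism.type G H).

Lemma signed_conj_morph s a o :
  f (signed_conj s a o) = signed_conj s (f a) (f o).
Proof. by case: s; rewrite /signed_conj gmulfJ ?gmulfV. Qed.

Lemma colored_morph (x : nat -> G) a w b :
  colored x a w b -> colored (f \o x) (f a) w (f b).
Proof.
elim: w a => /= [a ->|l w IH a] //; case: ifP => _; last first.
  by move=> /IH; rewrite signed_conj_morph.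
by case=> -> /IH.
Qed.

Lemma generating_morph (x : nat -> G) a w : (forall y, exists x, f x = y) ->
  generating x a w -> generating (f \o x) (f a) w.
Proof.
move=> f_surj gen S [S1 SF] Sa Sx y; have [h <-] := f_surj y.
pose T : {pred G} := fun h => f h \in S; apply: (gen T) => //.
by split=> [|u v Tu Tv]; rewrite -topredE /= /T ?gmulf1 ?gmulfF //; apply: SF.
Qed.

End Morphism.

(** Here the strand of color p passes under an arc whose color commutes with p,
    and so keeps its color, as the coloring pv of the rest of the code says. *)
Section CommutingCrossing.
Variables (G : groupType) (x : nat -> G) (a p : G) (c : nat) (s : bool).
Variables (u v : seq letter).
Local Notation w := (u ++ (c, false, s) :: v).
Hypothesis gw : gauss_code w.
Hypothesis up : colored x a u p.
Hypothesis xp : commute p (x c).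
Hypothesis pv : colored x p v a.
Hypothesis gen : generating x a w.

Let not_under : {in u ++ v, forall l, crossing l = c -> over l}.
Proof.
have : uniq (map fst ((c, false, s) :: (u ++ v))).
  have pw : perm_eq ((c, false, s) :: (u ++ v)) w.
    by rewrite -cat1s -[_ :: v]cat1s perm_catCA.
  by rewrite (perm_uniq (perm_map _ pw)); case/andP: gw.
move=> /= /andP[cuv _] [[d o] t] luv dc; apply: contraR cuv => no.
apply/mapP; exists (d, o, t) => //.
by rewrite /= -dc; case: (o) no.
Qed.

(** Removing a crossing must not lose a generator.  The under-passage of c has
    no effect, so the color x c is already reached from the other generators at
    the over-passage of c. *)
Let crossing_color S : group_closed S -> a \in S ->
  {in u ++ v, forall l, crossing l != c -> x (crossing l) \in S} -> x c \in S.
Proof.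
move=> gS Sa Sx; have auv : colored x a (u ++ v) a.
  by apply/colored_cat; exists p.
have [_ Sover] : a \in S /\ _ := colored_closed gS Sa
  (fun l luv ul => Sx l luv (contraNneq (fun lc => not_under luv lc) ul)) auv.
case/andP: gw => _ /allP/(_ (c, false, s)); rewrite mem_cat mem_head orbT.
move=> /(_ isT); rewrite mem_cat inE orbCA => /orP[/eqP//|].
by rewrite -mem_cat => /Sover; apply.
Qed.

Lemma coloring_generates_virtualize :
  coloring_generates G [seq l <- w | crossing l != c].
Proof.
have filt t b d : {in t, forall l, crossing l = c -> over l} ->
    colored x b t d -> colored x b [seq l <- t | crossing l != c] d.
  elim: t b => //= l t IH b /in_forall_cons[lc tc].
  case: eqP => /= [/lc-> [_ cb]|_]; first exact: IH.
  by case: ifP => _ => [[xb cb]|cb]; [split=> //|]; apply: IH.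
have [uc vc] := (in_forall_cat _ _ _).1 not_under.
exists x, a; rewrite filter_cat /= /crossing eqxx /=; split.
  by apply/colored_cat; exists p; apply: filt.
move=> S gS Sa Sx; apply: gen => // l.
have Sx' : {in u ++ v, forall l, crossing l != c -> x (crossing l) \in S}.
  by move=> k kuv kc; apply: Sx; rewrite -filter_cat mem_filter kc.
rewrite mem_cat inE orbCA -mem_cat => /predU1P[->|luv].
  exact: crossing_color.
have [->|] := eqVneq (crossing l) c; first exact: crossing_color.
exact: Sx'.
Qed.

(** The former over-passage of c becomes an under-passage, at which the strand
    of color x c is conjugated by p or its inverse, hence keeps its color. *)
Lemma coloring_generates_crossing_change :
  coloring_generates G [seq change_letter c l | l <- w].
Proof.
(* The overpass of the changed crossing is the former underpass. *)
pose x' := set_color x c p.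
have x'c : x' c = p by rewrite /x' /set_color eqxx.
have x'E d : d != c -> x' d = x d by rewrite /x' /set_color => /negbTE->.
have chg t b d : {in t, forall l, crossing l = c -> over l} ->
    colored x b t d -> colored x' b [seq change_letter c l | l <- t] d.
  elim: t b => //= l t IH b /in_forall_cons[lc tc].
  have [cl|cl] := eqVneq (crossing l) c.
    have -> : change_letter c l = (c, false, ~~ positive l).
      by rewrite /change_letter cl eqxx lc.
    rewrite lc //= cl /crossing /= x'c => -[xb cb].
    rewrite signed_conj_commute; first exact: IH.
    by rewrite -xb; apply: commute_sym.
  have -> : change_letter c l = l by rewrite /change_letter (negbTE cl).
  rewrite x'E //.
  by case: ifP => _ => [[xb cb]|cb]; [split=> //|]; apply: IH.
have [uc vc] := (in_forall_cat _ _ _).1 not_under.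
exists x', a; split.
  rewrite map_cat; apply/colored_cat; exists p; first exact: chg.
  rewrite /= {1 2}/change_letter /crossing /= eqxx /=; split=> //.
  exact: chg.
move=> S gS Sa Sx; apply: gen => // l.
have Sx' : {in u ++ v, forall l, crossing l != c -> x (crossing l) \in S}.
  move=> k kuv kc; have := Sx k; rewrite x'E //; apply.
  apply/mapP; exists k; first by rewrite mem_cat inE orbCA -mem_cat kuv orbT.
  by rewrite /change_letter (negbTE kc).
rewrite mem_cat inE orbCA -mem_cat => /predU1P[->|luv].
  exact: crossing_color.
have [->|] := eqVneq (crossing l) c; first exact: crossing_color.
exact: Sx'.
Qed.

End CommutingCrossing.

Lemma coloring_generates_quot (G : groupType) (D : diagram) c :
  c \in crossings D -> coloring_generates G D -> exists2 z, z \in derived G &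
    coloring_generates (quot (pred1 z)) (virtualize D c) /\
    coloring_generates (quot (pred1 z)) (crossing_change D c).
Proof.
case: D => w gw; rewrite mem_undup => /= /mapP[l0 l0w cE] [x [a [cw gen]]].
have [s cs] : exists s, (c, false, s) \in w.
  case/andP: (gw) => _ /allP/(_ _ l0w); rewrite -cE.
  case: l0 l0w cE => -[d [|]] s l0w /= cE lw; exists s => //.
  by rewrite cE.
case/splitPr: cs gw cw gen {l0 l0w cE} => u v gw.
move=> /colored_cat[p up] /= pv gen.
pose z := [~ p, x c]; exists z; first exact: derivedR.
pose f : UMagmaMorphism.type G (quot (pred1 z)) := @quot_pi G (pred1 z).
have xp : commute (f p) (f (x c)).
  apply/commgP; rewrite -gmulfR -/z; apply/eqP.
  rewrite -[RHS](gmulf1 (s := f)); apply/esym.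
  apply/quot_pi_eq; rewrite invg1 mul1g.
  by apply: normal_closure_sub; rewrite inE.
have fp : f (signed_conj s p (x c)) = f p.
  by rewrite signed_conj_morph signed_conj_commute.
have {}pv : colored (f \o x) (f p) v (f a).
  by rewrite -fp; apply: colored_morph.
have {}gen := generating_morph (f := f) (@quot_pi_surj _ _) gen.
have {}up := colored_morph f up.
split; [exact (coloring_generates_virtualize gw up pv gen)|].
exact (coloring_generates_crossing_change gw up xp pv gen).
Qed.

(** The code without crossings is colored by one element, so G is cyclic. *)
Lemma coloring_generates_nil (G : groupType) :
  coloring_generates G [::] -> derived_normally_generated G 0.
Proof.
move=> [x [a [_ gen]]].
pose C (b : G) : {pred G} := fun h => `[< commute h b >].
have CP b h : reflect (commute h b) (h \in C b) := asboolP _.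
have gC b : group_closed (C b).
  split=> [|g h /CP gb /CP hb]; apply/CP; apply/commute_sym.
    exact: commute1.
  by apply/commuteM; [|apply/commuteV]; apply/commute_sym.
have aC h : commute h a by apply/CP; apply: (gen _ (gC a)) => //; apply/CP.
have abG (g h : G) : commute g h.
  by apply/CP; apply: (gen _ (gC h)) => //; apply/CP/commute_sym.
exists [tuple]; split=> // h.
have [gN _] := normal_closure_normal (mem [tuple of [::] : seq G]).
apply/idP/idP => [|dh].
  by apply: normal_closure_min => //; apply: derived_normal.
move: h dh; apply: subgroup_gen_min => // _ /asboolP[g [h ->]].
by have /commgP/eqP -> := abG g h; case: gN.
Qed.

(** The group varies along the induction: each virtualization or crossing change
    passes to a quotient. *)
Lemma unknottable_derived th m n D : unknottable th m n D ->
  forall G : groupType,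
    coloring_generates G D -> derived_normally_generated G (m + n).
Proof.
elim=> {m n D} [D /eqquotP DU G|m n D c cD _ IH G|m n D c cD _ IH G].
- by move=> /(coloring_generates_equiv _ DU)/coloring_generates_nil.
- move=> /(coloring_generates_quot cD)[z dz [Gv _]].
  by apply: derived_normally_generated_quot dz _; apply: IH.
move=> /(coloring_generates_quot cD)[z dz [_ Gc]]; rewrite addnS.
by apply: derived_normally_generated_quot dz _; apply: IH.
Qed.

(** * The Wirtinger group is generated by a coloring *)

Section WirtingerColoring.
Variable w : seq letter.
Hypothesis gw : gauss_code w.
Local Notation G := (wirtinger_group w).

Let pi_pres (t : gword (arc_type w)) : G :=
  \pi_(pres_group (wirtinger_rels w)) t.

Let gen_arc (k : arc_type w) : G := pi_pres [:: (k, false)].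

(** The over-passage of c is looked up ignoring its sign, so that the color of a
    crossing depends on its label only. *)
Let over_arc (c : nat) : arc_type w :=
  arc w (find (fun l => l.1 == (c, true)) w).

Let pi_presM t t' : pi_pres (t ++ t') = pi_pres t * pi_pres t'.
Proof. exact/esym/pres_mulE. Qed.

Let pi_presV k : pi_pres [:: (k, true)] = (gen_arc k)^-1.
Proof. exact/esym/pres_invE. Qed.

Let find_over i : i < size w -> over (nth (0, false, false) w i) ->
  find (fun l => l.1 == (crossing (nth (0, false, false) w i), true)) w = i.
Proof.
move=> iw oi; set l := nth _ w i in oi *.
have lw : l \in w by apply: mem_nth.
have -> : find (fun k => k.1 == (crossing l, true)) w = index l.1 (map fst w).
  rewrite /index find_map; apply: eq_find => k /=.
  by move: oi; rewrite /over /crossing; case: l {lw} => -[d [|]].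
have -> : l.1 = nth l.1 (map fst w) i by rewrite (nth_map (0, false, false)).
by rewrite index_uniq ?size_map //; case/andP: gw.
Qed.

Let over_arcE c s :
  (c, true, s) \in w -> arc w (index (c, true, s) w) = over_arc c.
Proof.
move=> cw; rewrite /over_arc; congr (arc w _).
have := @find_over (index (c, true, s) w).
by rewrite index_mem nth_index // => ->.
Qed.

Let arc_under i : i < size w -> ~~ over (nth (0, false, false) w i) ->
  gen_arc (arc w i.+1) =
  signed_conj (positive (nth (0, false, false) w i)) (gen_arc (arc w i))
    (gen_arc (over_arc (crossing (nth (0, false, false) w i)))).
Proof.
move=> iw ui; set l := nth _ w i in ui *.
have lw : l \in w by apply: mem_nth.
have rw : wirtinger_rel w i \in wirtinger_rels w.
  by apply: map_f; rewrite mem_filter ui mem_iota.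
have -> : gen_arc (arc w i.+1) = pi_pres (wirtinger_rel w i).2.
  by apply/presP; exact: (PresRel rw).
rewrite /wirtinger_rel -/l /=.
have -> : arc w (index (crossing l, true, positive l) w) =
    over_arc (crossing l).
  apply: over_arcE; case/andP: gw => _ /allP/(_ l lw).
  by rewrite ui.
set o := over_arc _; rewrite -cat1s -[[:: (arc w i, _); _]]cat1s.
rewrite !pi_presM; case: (positive l);
  by rewrite /signed_conj conjgE ?invgK pi_presV.
Qed.

Let arc_over i : i < size w -> over (nth (0, false, false) w i) ->
  arc w i.+1 = arc w i.
Proof.
move=> iw oi; rewrite /arc; congr inZp.
rewrite (take_nth (0, false, false) iw) -cats1 /unders count_cat.
by rewrite /= oi !addn0.
Qed.

Let colored_drop i : i <= size w ->
  colored (gen_arc \o over_arc) (gen_arc (arc w i)) (drop i w)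
    (gen_arc (arc w (size w))).
Proof.
elim/ltn_ind: {i}(size w - i) {-2}i (erefl (size w - i)) => n IH i ni iw.
move: iw; rewrite leq_eqVlt => /predU1P[->|iw]; first by rewrite drop_size.
rewrite (drop_nth (0, false, false) iw) /=.
have IHi : colored (gen_arc \o over_arc) (gen_arc (arc w i.+1)) (drop i.+1 w)
    (gen_arc (arc w (size w))) by apply: (IH (size w - i.+1)) => //; lia.
case: ifP => oi; last by rewrite /= -arc_under ?oi.
split; last by rewrite -arc_over.
by rewrite /= /over_arc find_over.
Qed.

(** The arc counter wraps around: modulo the number n > 0 of arcs this is n = 0,
    and without crossings there is a single arc. *)
Let arc_size : arc w (size w) = arc w 0.
Proof.
apply: val_inj; rewrite /arc take_size take0 /=.
by case: (unders w) => //= n; rewrite modnn mod0n.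
Qed.

(** The counter of under-passages grows by steps of at most 1. *)
Let arc_surj (k : arc_type w) : exists2 i, i <= size w & arc w i = k.
Proof.
have take_surj (t : seq letter) n : n <= unders t ->
    exists2 i, i <= size t & unders (take i t) = n.
  elim: t n => [|l t IH] n; first by rewrite leqn0 => /eqP->; exists 0.
  case: n => [|n]; first by exists 0.
  rewrite {1}/unders /= -/(unders t) => nt.
  have [|i it iE] := IH (n.+1 - ~~ over l); first by lia.
  exists i.+1 => //; rewrite /unders /= -/(unders _) iE.
  by case: (over l) => /=; lia.
have [|i iw iE] := take_surj w (val k).
  by rewrite -ltnS; apply: leq_trans (ltn_ord k) _; rewrite ltnS leq_pred.
exists i => //; apply: val_inj; rewrite /arc iE; exact: modn_small (ltn_ord k).
Qed.

Lemma coloring_generates_wirtinger : coloring_generates G w.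
Proof.
exists (gen_arc \o over_arc), (gen_arc (arc w 0)); split.
  by have := @colored_drop 0 isT; rewrite drop0 arc_size.
move=> S gS Sa Sx; have Sarc k : gen_arc k \in S.
  have [i iw <-] := arc_surj k; elim: i iw => // i IH iw.
  case: (boolP (over (nth (0, false, false) w i))) => [oi|ui].
    by rewrite arc_over // IH // ltnW.
  rewrite arc_under //; apply: signed_conj_closed => //.
    by rewrite IH // ltnW.
  by apply: (Sx (nth (0, false, false) w i)); apply: mem_nth.
elim/quotW; elim=> [|[k b] t IH]; first by case: gS.
rewrite -/(pi_pres _) -cat1s pi_presM; apply: (group_closedM gS) => //.
by case: b; [rewrite pi_presV (group_closedV gS) | exact: Sarc].
Qed.

End WirtingerColoring.

(** * The Nakanishi index is at most the Ma-Qiu index *)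

Section Nakanishi.
Variables (G : groupType) (n : nat) (s : n.-tuple G).
Hypothesis sd : {subset s <= derived G}.
Local Open Scope ring_scope.
Local Notation M := (alexander_module G).

Definition derived_class (x : derived_group G) : M :=
  \pi_(abel (derived_group G)) x.

Definition class_tuple : n.-tuple M :=
  [tuple derived_class (Sub (tnth s i) (sd (mem_tnth i s))) | i < n].

Definition class_span : {pred G} := fun x => `[< exists dx : x \in derived G,
  exists a : 'I_n -> group_ring (abel G),
    derived_class (Sub x dx) = \sum_(i < n) a i *: tnth class_tuple i >].

Lemma derived_classF (x y : derived_group G) :
  derived_class (x / y)%g = derived_class x - derived_class y.
Proof.
by rewrite [LHS]pi_MD; congr (_ + _); apply/esym/(abel_invE y).
Qed.

(** The exponent z^-1 appears because the module structure lets the class of g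
    act by x |-> g x g^-1, whereas x ^ z is z^-1 x z. *)
Lemma class_span_normal : normal_subgroup class_span.
Proof.
have [d1 dF] := subgroup_gen_closed (commutators G).
split; first split.
- apply/asboolP; exists d1, (fun=> 0).
  rewrite big1; last by move=> i _; rewrite scale0r.
  have -> : Sub 1%g d1 = (1 / 1)%g :> derived_group G.
    by apply: val_inj; rewrite mulgV.
  by rewrite derived_classF subrr.
- move=> x y /asboolP[dx [a xE]] /asboolP[dy [b yE]]; apply/asboolP.
  exists (dF x y dx dy), (fun i => a i - b i).
  under eq_bigr do rewrite scalerBl.
  rewrite sumrB -xE -yE -derived_classF; congr derived_class.
  exact: val_inj.
move=> x z /asboolP[dx [a xE]]; apply/asboolP.
exists (derivedJ z dx), (fun i => gring_of (\pi_(abel G) z^-1%g) * a i).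
under eq_bigr do rewrite -scalerA.
rewrite -scaler_sumr -xE [RHS]alex_scale_of [RHS]alex_actE.
by congr derived_class; apply: val_inj; rewrite /= invgK.
Qed.

Lemma class_tuple_span : normal_closure (mem s) =i derived G ->
  forall x : M, exists a : 'I_n -> group_ring (abel G),
    x = \sum_(i < n) a i *: tnth class_tuple i.
Proof.
move=> sE; elim/(@quotW _ (abel (derived_group G))) => x.
have : val x \in class_span.
  have : val x \in normal_closure (mem s) by rewrite sE; apply: valP.
  apply: normal_closure_min => [|_ /tnthP[i ->]].
    exact: class_span_normal.
  apply/asboolP; exists (sd (mem_tnth i s)), (fun j => (j == i)%:R).
  rewrite (bigD1 i) //= eqxx scale1r big1 => [|j /negbTE->].
    by rewrite addr0 tnth_mktuple.
  exact: scale0r.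
move=> /asboolP[dx [a xE]]; exists a; rewrite -xE /derived_class; congr \pi.
exact: val_inj.
Qed.

End Nakanishi.

(** * The two inequalities *)

Local Open Scope ring_scope.

Lemma least_le (P Q : nat -> Prop) :
  (forall n, P n -> Q n) -> (least Q <= least P)%E.
Proof.
move=> PQ; rewrite {2}/least; case: pselect => [exP|_]; last exact: leey.
case: ex_minnP => n /asboolP/PQ Qn _; rewrite /least; case: pselect => [exQ|[]].
  case: ex_minnP => m _ /(_ n); rewrite lee_fin lez_nat; apply.
  exact/asboolP.
by exists n; apply/asboolP.
Qed.

Lemma least_le_nat (P : nat -> Prop) n : P n -> (least P <= n%:Z%:E)%E.
Proof.
move=> Pn; rewrite /least; case: pselect => [exP|[]].
  case: ex_minnP => m _ /(_ n); rewrite lee_fin lez_nat; apply.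
  exact/asboolP.
by exists n; apply/asboolP.
Qed.

Lemma nakanishi_le_ma_qiu (G : groupType) :
  (nakanishi_index G <= ma_qiu_index G)%E.
Proof.
apply: least_le => n [s [sd sE]]; exists (class_tuple sd).
exact: class_tuple_span.
Qed.

Theorem corollary7 (th : knot_theory) (K : knot th) (m n : nat) (D : diagram)
    (DK : represents D K) (Dmn : unknottable th m n D) :
  (nakanishi_index (knot_group K) <= ma_qiu_index (knot_group K)
     <= (m + n)%N%:Z%:E)%E.
Proof.
rewrite nakanishi_le_ma_qiu; apply: least_le_nat.
apply: (unknottable_derived Dmn).
have KD : diagram_equiv th (repr K) D.
  by apply/eqquotP; apply: etrans (reprK K) (esym DK).
exact/(coloring_generates_equiv _ KD)/coloring_generates_wirtinger/gcodeP.
Qed.
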